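(* For any integer $q\ge 1$, there exists a connected graph $G$ such that $edim(G)-dim(G)\ge q$.
   Context: All graphs are finite and simple. For a connected graph $G=(V,E)$, $d_G(x,y)$ is the length of a shortest path between vertices $x,y$. A vertex $v$ distinguishes two vertices $x,y$ if $d_G(v,x)\neq d_G(v,y)$. A set $S\subseteq V$ is a metric generator for $G$ if any two distinct vertices of $G$ are distinguished by some element of $S$; the metric dimension $dim(G)$ is the minimum cardinality of a metric generator. The distance between a vertex $v$ and an edge $e=uw$ is $d_G(e,v)=\min\{d_G(u,v),d_G(w,v)\}$. A vertex $w$ distinguishes two edges $e_1,e_2$ if $d_G(w,e_1)\ne d_G(w,e_2)$. A set $S\subseteq V$ is an edge metric generator for $G$ if every two distinct edges of $G$ are distinguished by some vertex of $S$; the edge metric dimension $edim(G)$ is the smallest cardinality of an edge metric generator for $G$. *)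

(* Defs.v *)
From mathcomp Require Import all_boot.

Set Implicit Arguments.
Unset Strict Implicit.
Unset Printing Implicit Defensive.

Record sgraph := SGraph {
  vertex :> finType;
  adj : rel vertex;
  adj_sym : symmetric adj;
  adj_irrefl : irreflexive adj
}.

Definition connected (G : sgraph) : Prop :=
  0 < #|G| /\ forall x y : G, connect (@adj G) x y.

Definition edges (G : sgraph) : {set {set G}} :=
  [set [set u; w] | u in G, w in G & adj u w].

Definition has_path (G : sgraph) (x y : G) (n : nat) : bool :=
  [exists p : n.-tuple G,
    [&& path (@adj G) x p, last x p == y & uniq (x :: p)]].

(* A path has fewer than #|G| edges, so the default value #|G| is taken exactly
   when y is not reachable from x. *)
Definition dist (G : sgraph) (x y : G) : nat :=
  \big[minn/#|G|]_(n < #|G| | has_path x y n) (n : nat).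

(* On an edge [set u; w] this is minn (dist u v) (dist w v): see edge_distE. *)
Definition edge_dist (G : sgraph) (e : {set G}) (v : G) : nat :=
  \big[minn/#|G|]_(u in e) dist u v.

Definition metric_generator (G : sgraph) (S : {set G}) : bool :=
  [forall x : G, forall y : G, (x != y) ==>
    [exists v in S, dist v x != dist v y]].

Definition edge_metric_generator (G : sgraph) (S : {set G}) : bool :=
  [forall e1 in edges G, forall e2 in edges G, (e1 != e2) ==>
    [exists w in S, edge_dist e1 w != edge_dist e2 w]].

(* The full vertex set is a generator of both kinds (metric_generatorT,
   edge_metric_generatorT), so both minima are over nonempty families. *)
Definition mdim (G : sgraph) : nat :=
  #|[arg min_(S < [set: G] | metric_generator S) #|S|]|.

Definition edim (G : sgraph) : nat :=
  #|[arg min_(S < [set: G] | edge_metric_generator S) #|S|]|.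

Section BasicFacts.
Variable G : sgraph.
Implicit Types (x y u v w : G) (e S : {set G}).

Lemma edgesP e :
  reflect (exists u w, adj u w /\ e = [set u; w]) (e \in edges G).
Proof.
apply: (iffP imset2P) => [[u w _ + ->] | [u [w [uw ->]]]].
  by rewrite inE => uw; exists u, w.
by exists u w; rewrite ?inE.
Qed.

Lemma bigminn_leP (I : finType) (P : pred I) (F : I -> nat) d m :
  reflect (m <= d /\ forall i, P i -> m <= F i)
          (m <= \big[minn/d]_(i | P i) F i).
Proof.
apply: (iffP idP) => [le_m | [le_d le_F]]; last first.
  by elim/big_ind: _ => // a b le_a le_b; rewrite leq_min le_a.
suff {le_m}: \big[minn/d]_(i | P i) F i <= d /\
             forall i, P i -> \big[minn/d]_(i | P i) F i <= F i.
  case=> le_d le_F; split=> [|i Pi]; first exact: leq_trans le_d.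
  exact: leq_trans le_m (le_F i Pi).
rewrite -big_filter; split.
  by elim: filter => [|i s IH]; rewrite ?big_nil // big_cons geq_min IH orbT.
move=> i Pi; have: i \in filter P (index_enum I).
  by rewrite mem_filter Pi mem_index_enum.
elim: filter => [|j s IH] //; rewrite in_cons big_cons geq_min.
by case/predU1P=> [-> | /IH->]; rewrite ?leqnn ?orbT.
Qed.

Lemma dist_le x y : dist x y <= #|G|.
Proof. by have /bigminn_leP[] := leqnn (dist x y). Qed.

Lemma has_path_lt x y n : has_path x y n -> n < #|G|.
Proof.
case/existsP=> p /and3P[_ _ /card_uniqP cU].
by rewrite -(size_tuple p) -[_.+1]/(size (x :: p)) -cU max_card.
Qed.

Lemma dist_min x y n : has_path x y n -> dist x y <= n.
Proof.
move=> xyn; have /bigminn_leP[_ le_d] := leqnn (dist x y).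
exact: le_d (Ordinal (has_path_lt xyn)) xyn.
Qed.

Lemma dist_lt_has_path x y : dist x y < #|G| -> has_path x y (dist x y).
Proof.
rewrite /dist; elim/big_ind: _ => //; first by rewrite ltnn.
by move=> a b Ha Hb; rewrite /minn; case: ifP.
Qed.

Lemma dist_has_path x y : connect (@adj G) x y -> has_path x y (dist x y).
Proof.
case/connectP=> p0 /shortenP[p xp Up _] Dy.
have pP : has_path x y (size p).
  by apply/existsP; exists (in_tuple p); rewrite xp -Dy eqxx.
exact: dist_lt_has_path (leq_ltn_trans (dist_min pP) (has_path_lt pP)).
Qed.

Lemma dist_eq0 x y : (dist x y == 0) = (x == y).
Proof.
apply/idP/eqP=> [/eqP d0 | ->].
  have /dist_lt_has_path: dist x y < #|G|.
    by rewrite d0; apply/card_gt0P; exists x.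
  by rewrite d0 => /existsP[p]; rewrite tuple0 /= => /andP[/eqP].
rewrite -leqn0; apply: dist_min; apply/existsP.
by exists [tuple]; rewrite /= eqxx.
Qed.

Lemma edge_distE u w v :
  edge_dist [set u; w] v = minn (dist u v) (dist w v).
Proof.
apply/eqP; rewrite eqn_leq; apply/andP; split.
  have /bigminn_leP[_ le_d] := leqnn (edge_dist [set u; w] v).
  by rewrite leq_min !le_d ?set21 ?set22.
apply/bigminn_leP; split=> [|i]; first by rewrite geq_min dist_le.
by case/set2P=> ->; rewrite geq_min leqnn ?orbT.
Qed.

Lemma edge_dist_eq0 e v : (edge_dist e v == 0) = (v \in e).
Proof.
have G0 : 0 < #|G| by apply/card_gt0P; exists v.
apply/idP/idP=> [|ve]; last first.
  have /bigminn_leP[_ /(_ v ve)] := leqnn (edge_dist e v).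
  by rewrite -leqn0; have /eqP-> : dist v v == 0 by rewrite dist_eq0.
apply: contraLR => vNe; rewrite -lt0n; apply/bigminn_leP; split=> // u ue.
by rewrite lt0n dist_eq0; apply: contraNneq vNe => <-.
Qed.

Lemma metric_generatorT : metric_generator [set: G].
Proof.
apply/forallP=> x; apply/forallP=> y; apply/implyP=> xy.
apply/existsP; exists x; rewrite inE /=.
have /eqP-> : dist x x == 0 by rewrite dist_eq0.
by rewrite eq_sym dist_eq0.
Qed.

Lemma edge_metric_generatorT : edge_metric_generator [set: G].
Proof.
apply/forall_inP=> e1 _; apply/forall_inP=> e2 _; apply/implyP.
apply: contraR; rewrite negb_exists => /forallP E; apply/eqP/setP=> v.
move: (E v); rewrite inE /= negbK => /eqP Ev.
by rewrite -!edge_dist_eq0 Ev.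
Qed.

End BasicFacts.

(* Main.v *)
Require Import Defs.
From mathcomp Require Import all_boot all_order all_algebra.

(** The witness is the friendship graph: [k] triangles sharing one hub, with
    [k = q + 1].

    In any graph with a dominating vertex [h], the edges [h x] and [h y] look
    alike from every vertex other than [x] and [y]: both are at distance 0 from
    [h] and at distance 1 from everything else.  An edge metric generator must
    therefore contain [x] or [y] for every two non-hub vertices, so it misses at
    most one of them and the edge metric dimension is at least [#|G| - 2]
    ([edim_dominating]); here this is [2 k - 1].

    For the vertices, choosing one non-hub vertex in each triangle is enough,
    because its neighbours are exactly its partner and the hub: the partner is
    told apart from any other partner by adjacency, and from the hub by a chosen
    vertex of another triangle.  Hence the metric dimension is at most [k]
    ([mdim_friendship]) and the difference is at least [k - 1 = q]. *)

Set Implicit Arguments.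
Unset Strict Implicit.
Unset Printing Implicit Defensive.

Section Distances.
Variable G : sgraph.
Implicit Types (x y h : G) (S : {set G}).

Lemma dist_eq1 x y : (dist x y == 1) = adj x y.
Proof.
apply/idP/idP=> [/eqP d1 | xy].
  have neq_xy : x != y by rewrite -dist_eq0 d1.
  have /dist_lt_has_path : dist x y < #|G|.
    rewrite d1; apply: leq_trans (max_card (mem [set x; y])).
    by rewrite cards2 neq_xy.
  rewrite d1 => /existsP[p]; case/tupleP: p => z p; rewrite tuple0 /=.
  by rewrite andbT => /and3P[xz /eqP <- _].
have neq_xy : x != y by apply: contraTneq xy => ->; rewrite adj_irrefl.
apply/eqP/anti_leq; rewrite lt0n dist_eq0 neq_xy andbT.
apply: dist_min; apply/existsP; exists [tuple y].
by rewrite /= xy eqxx inE neq_xy.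
Qed.

Lemma mdim_le S : metric_generator S -> mdim G <= #|S|.
Proof.
rewrite /mdim => gS; case: arg_minnP => [|T _]; last exact.
exact: metric_generatorT.
Qed.

Lemma edge_metric_generator_edim :
  exists2 S : {set G}, edge_metric_generator S & #|S| = edim G.
Proof.
rewrite /edim; case: arg_minnP => [|S gS _]; first exact: edge_metric_generatorT.
by exists S.
Qed.

Lemma connected_dominating h : (forall x, x != h -> adj h x) -> connected G.
Proof.
move=> dom; split=> [|x y]; first by apply/card_gt0P; exists h.
have hub z : connect (@adj G) h z.
  by have [->|/dom/connect1] := eqVneq z h.
apply: connect_trans (hub y).
by rewrite (sym_connect_sym (@adj_sym G)).
Qed.

Lemma edge_dist_dominating h x v : (forall y, y != h -> adj h y) ->
  edge_dist [set h; x] v = (v \notin [set h; x]).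
Proof.
move=> dom; have [ve|vNe] := boolP (v \in [set h; x]).
  by apply/eqP; rewrite edge_dist_eq0.
apply/eqP; rewrite eqn_leq lt0n edge_dist_eq0 vNe andbT edge_distE geq_min.
have vh : v != h by apply: contraNneq vNe => ->; rewrite set21.
by have /eqP-> : dist h v == 1 by rewrite dist_eq1 dom.
Qed.

(** Two non-hub vertices [x] and [y] outside a generator would leave the edges
    [h x] and [h y] undistinguished, so the complement of a generator contains
    at most the hub and one other vertex. *)
Lemma edim_dominating h : (forall x, x != h -> adj h x) -> #|G| <= (edim G).+2.
Proof.
move=> dom; have [S /forall_inP gS <-] := edge_metric_generator_edim.
rewrite -(cardsC S) -addn2 leq_add2l (cardsD1 h) -[2]/(1 + 1) leq_add ?leq_b1 //.
rewrite leqNgt; apply/card_gt1P=> -[x [y []]].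
rewrite !inE => /andP[xh xS] /andP[yh yS] neq_xy.
have edge_h z : z != h -> [set h; z] \in edges G.
  by move=> zh; apply/edgesP; exists h, z; rewrite dom.
have /forall_inP/(_ _ (edge_h y yh))/implyP := gS _ (edge_h x xh).
case/(_ _)/existsP=> [|w /andP[wS]].
  apply: contraNneq neq_xy => /setP/(_ x).
  by rewrite !inE eqxx orbT (negPf xh) => /esym.
have wx : w != x by apply: contraNneq xS => <-.
have wy : w != y by apply: contraNneq yS => <-.
by rewrite !edge_dist_dominating // !inE (negPf wx) (negPf wy) eqxx.
Qed.

End Distances.

Section Friendship.
Variable k : nat.

(** [None] is the hub, and the pair of non-hub vertices of triangle [i] is
    [Some (i, true)] and [Some (i, false)]. *)
Definition friend_rel (u v : option ('I_k * bool)) : bool :=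
  match u, v with
  | Some (i, b), Some (j, c) => (i == j) && (b != c)
  | None, None => false
  | _, _ => true
  end.

Lemma friend_rel_sym : symmetric friend_rel.
Proof. by move=> [[i b]|] [[j c]|] //=; rewrite eq_sym (eq_sym b). Qed.

Lemma friend_rel_irrefl : irreflexive friend_rel.
Proof. by move=> [[i b]|] //=; rewrite !eqxx. Qed.

Definition friendship := SGraph friend_rel_sym friend_rel_irrefl.

Lemma card_friendship : #|friendship| = (k * 2).+1.
Proof. by rewrite card_option card_prod card_ord card_bool. Qed.

Lemma friendship_dominating (x : friendship) :
  x != None -> adj (None : friendship) x.
Proof. by case: x. Qed.

(** With a single triangle the hub and the unchosen vertex would be twins,
    whence [1 < k]. *)
Lemma mdim_friendship : 1 < k -> mdim friendship <= k.
Proof.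
move=> k_gt1; pose a (i : 'I_k) : friendship := Some (i, true).
rewrite -[leqRHS]card_ord; apply: leq_trans (leq_imset_card a predT).
apply: mdim_le; set S := a @: _.
have aS i : a i \in S by apply: imset_f.
(* A vertex of S is at distance 0 from itself alone; two vertices outside S are
   separated by adjacency, as only adjacency means distance 1. *)
suff sep x y : x != y -> exists2 v, v \in S & dist v x != dist v y.
  apply/forallP=> x; apply/forallP=> y; apply/implyP=> /sep[v vS dv].
  by apply/existsP; exists v; rewrite vS.
have by_adj v u w : adj v u -> ~~ adj v w -> dist v u != dist v w.
  by rewrite -!dist_eq1 => /eqP->; rewrite eq_sym.
have self v u : v != u -> dist v v != dist v u.
  have /eqP-> : dist v v == 0 by rewrite dist_eq0.
  by rewrite [0 == _]eq_sym dist_eq0.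
have other (i : 'I_k) : exists j : 'I_k, j != i.
  have /card_gt0P[j] : 0 < #|predC1 i|
    by rewrite cardC1 card_ord -subn1 subn_gt0.
  by exists j.
case: x y => [[i []]|] [[j []]|] neq_xy.
- by exists (a i) => //; apply: self.
- by exists (a i) => //; apply: self.
- by exists (a i) => //; apply: self.
- by exists (a j) => //; rewrite eq_sym; apply: self; rewrite eq_sym.
- exists (a i) => //; apply: by_adj; first by rewrite /= eqxx.
  by apply: contraNN neq_xy => /andP[/eqP->].
- have [l li] := other i; exists (a l) => //.
  by rewrite eq_sym; apply: by_adj; rewrite //= (negPf li).
- by exists (a j) => //; rewrite eq_sym; apply: self; rewrite eq_sym.
- have [l lj] := other j; exists (a l) => //.
  by apply: by_adj; rewrite //= (negPf lj).
- by rewrite eqxx in neq_xy.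
Qed.

End Friendship.

Theorem proposition11 (q : int) (hq : (1 <= q)%R) :
  exists G : sgraph,
    connected G /\ ((edim G)%:Z - (mdim G)%:Z >= q)%R.
Proof.
case: q hq => [q|q] // q_gt0; exists (friendship q.+1).
split; first exact: connected_dominating (@friendship_dominating _).
have edim_ge := edim_dominating (@friendship_dominating q.+1).
have mdim_ub : mdim (friendship q.+1) <= q.+1 by apply: mdim_friendship.
rewrite card_friendship in edim_ge.
rewrite Num.Theory.lerBrDr -PoszD lez_nat -2!ltnS.
apply: leq_trans edim_ge; rewrite muln2 -addnn addSn !ltnS.
by rewrite leq_add2l.
Qed.
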